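(* Let $f$ be a strictly monotonic and infinitely differentiable function on an interval $I\subseteq\mathbb{R}$ with $f(I)=(0,+\infty)$, let $g$ be a symmetric distribution function, and let $\mathscr{I}^*_{f,g}$ be the $g$-weighted integral mean of the second kind with integrality function $f$, i.e. the mean given by $$\mathscr{I}^*_{f,g}(x,y)=\int_0^1 f\left(t f^{-1}(x)+(1-t)f^{-1}(y)\right)g(t)\,dt\quad(\forall x,y>0).$$ Then its characteristic function is $$Q_{\mathscr{I}^*_{f,g}}=\mu(g)\,\frac{(f^{-1})''}{(f^{-1})'},\qquad\text{where } \mu(g):=\int_0^1 t(1-t)g(t)\,dt>0.$$
   Context: A mean is a function $M:(0,+\infty)^2\to(0,+\infty)$ of class $C^\infty$ such that $\min(x,y)\le M(x,y)\le\max(x,y)$ and $M(x,y)=M(y,x)$ for all $x,y>0$. In particular, the mean $\mathscr{I}^*_{f,g}$ is by definition of class $C^\infty$. The characteristic function of a mean $M$ is $Q_M:(0,+\infty)\to\mathbb{R}$, $Q_M(x):=\frac{\partial^2 M}{\partial x^2}(x,x)$ (second partial derivative with respect to the first variable, evaluated at $(x,x)$). A function $g:[0,1]\to\mathbb{R}$ is a symmetric distribution function if: (i) $g\ge0$ almost everywhere on $[0,1]$; (ii) $g$ is Lebesgue-integrable on $[0,1]$ with $\int_0^1 g(t)\,dt=1$; (iii) $g(t)=g(1-t)$ for almost all $t\in[0,1]$. Here $f^{-1}:(0,+\infty)\to I$ is the inverse function of $f$. *)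

(* Defs.v *)
From HB Require Import structures.
From mathcomp Require Import all_boot all_order all_algebra.
From mathcomp Require Import all_classical all_reals all_analysis.

Set Implicit Arguments.
Unset Strict Implicit.
Unset Printing Implicit Defensive.

Import Order.TTheory GRing.Theory Num.Theory.
Import numFieldNormedType.Exports.

Local Open Scope classical_set_scope.
Local Open Scope ring_scope.

(* Functions on an interval of the real line, or on the open quadrant
   (0,+oo)^2, are represented by total functions whose values outside the
   domain are never constrained nor used. *)

(* [derivable] is two-sided, hence only reads f near x.  At an endpoint of I
   belonging to I it would involve values of f outside I; this is harmless here,
   since a continuous strictly monotonic f with f(I) open forces I to be open. *)
Definition smooth_on (R : realType) (I : interval R) (f : R -> R) : Prop :=
  forall n, {in I, forall x : R, derivable (derive1n n f) x 1}.

Definition strictly_monotonic_on (R : realType) (I : interval R) (f : R -> R)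
    : Prop :=
  {in I &, {homo f : x y / x < y}} \/ {in I &, {homo f : x y /~ x < y}}.

Definition partial1 (R : realType) (M : R -> R -> R) (x y : R) : R :=
  derive1 (M ^~ y) x.

Definition partial2 (R : realType) (M : R -> R -> R) (x y : R) : R :=
  derive1 (M x) y.

(* Class C^n on the open quadrant: all iterated partial derivatives of order
   at most n exist and are (jointly) continuous. *)
Fixpoint Cn_quadrant (R : realType) (n : nat) (M : R -> R -> R) : Prop :=
  (forall x y : R, 0 < x -> 0 < y ->
     {for (x, y), continuous (fun p : R * R => M p.1 p.2)}) /\
  if n is m.+1 then
    [/\ forall x y : R, 0 < x -> 0 < y ->
          derivable (M ^~ y) x 1 /\ derivable (M x) y 1,
        Cn_quadrant m (partial1 M) &
        Cn_quadrant m (partial2 M)]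
  else True.

Definition smooth_quadrant (R : realType) (M : R -> R -> R) : Prop :=
  forall n, Cn_quadrant n M.

Definition is_mean (R : realType) (M : R -> R -> R) : Prop :=
  [/\ smooth_quadrant M,
      forall x y : R, 0 < x -> 0 < y -> 0 < M x y,
      forall x y : R, 0 < x -> 0 < y -> Num.min x y <= M x y <= Num.max x y &
      forall x y : R, 0 < x -> 0 < y -> M x y = M y x].

Definition characteristic (R : realType) (M : R -> R -> R) (x : R) : R :=
  partial1 (partial1 M) x x.

(* The completed measure is used so that g is only required to be Lebesgue
   measurable; [lebesgue_measure] would restrict to Borel functions. *)
Notation lebmes := completed_lebesgue_measure.

Definition symmetric_distribution (R : realType) (g : R -> R) : Prop :=
  [/\ {ae lebmes, forall t : R, t \in `[0, 1] -> 0 <= g t},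
      lebmes.-integrable `[0, 1] (EFin \o g),
      \int[lebmes]_(t in `[0, 1]) g t = 1 &
      {ae lebmes, forall t : R, t \in `[0, 1] -> g t = g (1 - t)}].

(* finv plays the role of f^{-1}; outside (0,+oo) it is arbitrary. *)
Definition integral_mean2 (R : realType) (finv f g : R -> R) (x y : R) : R :=
  \int[lebmes]_(t in `[0, 1]) (f (t * finv x + (1 - t) * finv y) * g t).

Definition mu (R : realType) (g : R -> R) : R :=
  \int[lebmes]_(t in `[0, 1]) (t * (1 - t) * g t).

(* Main.v *)
Require Import Defs.
From HB Require Import structures.
From mathcomp Require Import all_boot all_order all_algebra.
From mathcomp Require Import all_classical all_reals all_analysis.
From mathcomp Require Import measurable_realfun ring lra.

Set Implicit Arguments.
Unset Strict Implicit.
Unset Printing Implicit Defensive.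

Import Order.TTheory GRing.Theory Num.Theory.
Import numFieldNormedType.Exports.

Local Open Scope classical_set_scope.
Local Open Scope ring_scope.

(** Write M for the mean, h for the inverse of f, c = f a, and <phi> for the
    integral of phi(t) g(t) over [0,1], so that mu(g) = <t> - <t^2> and
        M (f (a + s), c) = < f (a + t s) >                               (E)
    for small s.  Instead of differentiating under the integral sign, both
    sides of (E) are expanded to second order in s and compared.

    The right-hand side is handled by averaging the Taylor polynomial of f
    ([quad_expansion_average]): its coefficients are f'(a) <t> and
    f''(a)/2 <t^2>.  On the left, the slope of M (., c) at c is 1/2, because
    M is symmetric, of class C^1, and M (x, x) = x ([mean_partial1_diag]); its
    second-order coefficient is half the characteristic Q(c) by definition.
    Composing with the expansion of f ([quad_expansion_comp]) and using the
    uniqueness of the coefficients yields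
        f'(a) / 2 = f'(a) <t>,
        f''(a) / 4 + Q(c) f'(a)^2 / 2 = f''(a) / 2 <t^2>.
    As f is not constant, f' does not vanish identically, so the first line
    gives <t> = 1/2, hence mu(g) = 1/2 - <t^2>.  Once f'(a) is known to be
    nonzero, h'(c) = 1 / f'(a) and h''(c) = - f''(a) / f'(a)^3, so that the
    second line reads Q(c) = mu(g) h''(c) / h'(c).

    It remains to see that f' has no zero on I ([derive_neq0_of_average]).
    Say f is increasing; the decreasing case follows by changing signs.  If
    f'(a) = 0, monotonicity forces f''(a) = 0, so F(s) = f (a + s) - f a is
    o(s^2).  Then F(s) / s^2 tends to 0 at 0 and has a maximum on every small
    interval ]0, s0] ([flat_record]); at such a maximum point s one has
    F(t s) <= t^2 F(s) for t in [0,1], and (E) gives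
        M (c + F(s), c) - c <= <t^2> F(s)
    with <t^2> < 1/2, contradicting the slope 1/2 of M (., c) at c. *)

(** * Averages against a symmetric distribution function *)

(** Completed Lebesgue-measurable sets are carried by the Caratheodory type,
    whereas continuity arguments produce Borel measurability. *)
Lemma measurable_fun_completed (R : realType) (D : set R) (phi : R -> R) :
  measurable D -> measurable_fun D phi ->
  measurable_fun (T := caratheodory_type (R := R) (wlength idfun)^*%mu) D phi.
Proof. by move=> mD mphi _ Y mY; apply: sub_caratheodory; exact: mphi. Qed.

Lemma measurable_itv01_completed (R : realType) :
  measurable (`[0, 1]%classic :
    set (caratheodory_type (R := R) (wlength idfun)^*%mu)).
Proof. by apply: sub_caratheodory; exact: (@measurable_itv R `[0, 1]). Qed.

Lemma completed_lebesgue_set1 (R : realType) (a : R) : lebmes [set a] = 0%E.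
Proof. exact: lebesgue_measure_set1. Qed.

Lemma integrable_continuousM (R : realType) (g phi : R -> R) :
  lebmes.-integrable `[0, 1] (EFin \o g) ->
  {within `[0, 1], continuous phi} ->
  lebmes.-integrable `[0, 1] (EFin \o (fun t => phi t * g t)).
Proof.
move=> ig cphi.
have -> : EFin \o (fun t => phi t * g t) =
  ((EFin \o phi) \* (EFin \o g))%E by [].
apply: integrableMr => //.
- exact: measurable_itv01_completed.
- apply: measurable_fun_completed; first exact: measurable_itv.
  by apply: subspace_continuous_measurable_fun => //; exact: measurable_itv.
- have := continuous_compact cphi (@segment_compact _ 0 1).
  move/compact_bounded => [M [Mr HM]]; exists M; split => // x Mx y /= y01.
  by apply: (HM x Mx); exists y.
Qed.

Definition average (R : realType) (g phi : R -> R) : R :=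
  \int[lebmes]_(t in `[0, 1]) (phi t * g t).

(** The weight is only nonnegative almost everywhere, so positivity goes through
    the almost-everywhere equality of phi g with its absolute value. *)
Lemma average_ge0 (R : realType) (g phi : R -> R) : symmetric_distribution g ->
  {within `[0, 1], continuous phi} -> (forall t, 0 <= t <= 1 -> 0 <= phi t) ->
  0 <= average g phi.
Proof.
move=> [g0 ig _ _] cphi phi0.
have iphig := integrable_continuousM ig cphi.
rewrite /average /Rintegral.
suff -> : (\int[lebmes]_(t in `[0%R, 1%R]) (phi t * g t)%:E =
           \int[lebmes]_(t in `[0%R, 1%R]) `|(phi t * g t)%:E|)%E.
  by apply: fine_ge0; apply: integral_ge0.
apply: ae_eq_integral.
- exact: measurable_itv01_completed.
- by have /integrableP[] := iphig.
- by have /integrableP[] := integrable_abse iphig.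
- move: g0; apply: (@filterS _ _ (ae_filter_ringOfSetsType lebmes)) => t g0 /= t01.
  rewrite ger0_norm// mulr_ge0//; last by apply: g0; rewrite inE.
  by apply: phi0; move: t01; rewrite in_itv.
Qed.

(** A vanishing average would make phi g, hence g, vanish almost everywhere on
    [0,1] (the two endpoints form a null set), against the total mass 1. *)
Lemma average_gt0 (R : realType) (g phi : R -> R) : symmetric_distribution g ->
  {within `[0, 1], continuous phi} -> (forall t, 0 < t < 1 -> 0 < phi t) ->
  0 < average g phi.
Proof.
move=> gd cphi phi0; have [g0 ig g1 _] := gd.
have iphig := integrable_continuousM ig cphi.
have n0 : {ae lebmes, forall t : R, t != 0} by
  exists [set 0]; split;
    [exact: sub_caratheodory (@measurable_set1 R 0)
    |exact: completed_lebesgue_set1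
    |move=> t /= /negP; rewrite negbK => /eqP].
have n1 : {ae lebmes, forall t : R, t != 1} by
  exists [set 1]; split;
    [exact: sub_caratheodory (@measurable_set1 R 1)
    |exact: completed_lebesgue_set1
    |move=> t /= /negP; rewrite negbK => /eqP].
have inner (t : R) : t \in `[0, 1] -> t != 0 -> t != 1 -> 0 < t < 1.
  rewrite in_itv /= => /andP[].
  by rewrite !le_eqVlt eq_sym => /orP[->|->] // /orP[->|->].
have eabs : (\int[lebmes]_(t in `[0%R, 1%R]) (phi t * g t)%:E =
             \int[lebmes]_(t in `[0%R, 1%R]) `|(phi t * g t)%:E|)%E.
  apply: ae_eq_integral.
  - exact: measurable_itv01_completed.
  - by have /integrableP[] := iphig.
  - by have /integrableP[] := integrable_abse iphig.
  - move: g0 n0 n1; apply: (@filterS3 _ _ (ae_filter_ringOfSetsType lebmes)).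
    move=> t g0 t0 t1 /= t01.
    have t01' : t \in `[0, 1] by rewrite inE.
    by rewrite ger0_norm// mulr_ge0// ?g0//; apply/ltW/phi0/inner.
have := integrable_fin_num (@measurable_itv01_completed R) iphig.
rewrite /average /Rintegral lt_neqAle => fin; apply/andP; split; last first.
  by rewrite eabs; apply: fine_ge0; apply: integral_ge0.
apply/negP => /eqP /esym int0.
have : (\int[lebmes]_(t in `[0%R, 1%R]) `|(phi t * g t)%:E| = 0)%E.
  by rewrite -eabs -(fineK fin) int0.
move=> /(ae_eq_integral_abs lebmes (@measurable_itv01_completed R)) -/(_ _).
move=> /(_ (proj1 (integrableP _ _ _ iphig))) phig0.
have : (\int[lebmes]_(t in `[0%R, 1%R]) (g t)%:E =
        \int[lebmes]_(t in `[0%R, 1%R]) (cst 0 t))%E.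
  apply: ae_eq_integral.
  - exact: measurable_itv01_completed.
  - by have /integrableP[] := ig.
  - exact: measurable_cst.
  - move: phig0 n0 n1; apply: (@filterS3 _ _ (ae_filter_ringOfSetsType lebmes)).
    move=> t pg0 t0 t1 /= t01.
    have t01' : t \in `[0, 1] by rewrite inE.
    have [/eqP] := pg0 t01.
    by rewrite mulf_eq0 gt_eqF ?phi0 ?inner//= => /eqP ->.
move: g1; rewrite /Rintegral => + eg; rewrite eg integral0 /= => /esym/eqP.
by rewrite oner_eq0.
Qed.

Lemma averageD (R : realType) (g phi psi : R -> R) :
  symmetric_distribution g ->
  {within `[0, 1], continuous phi} -> {within `[0, 1], continuous psi} ->
  average g (fun t => phi t + psi t) = average g phi + average g psi.
Proof.
move=> [_ ig _ _] cphi cpsi; rewrite /average -RintegralD.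
- by apply: eq_Rintegral => t _; rewrite mulrDl.
- exact: measurable_itv01_completed.
- exact: integrable_continuousM.
- exact: integrable_continuousM.
Qed.

Lemma averageZ (R : realType) (g phi : R -> R) (k : R) :
  symmetric_distribution g -> {within `[0, 1], continuous phi} ->
  average g (fun t => k * phi t) = k * average g phi.
Proof.
move=> [_ ig _ _] cphi; rewrite /average -RintegralZl.
- by apply: eq_Rintegral => t _; rewrite mulrA.
- exact: measurable_itv01_completed.
- exact: integrable_continuousM.
Qed.

Lemma average_cst (R : realType) (g : R -> R) (k : R) :
  symmetric_distribution g -> average g (fun=> k) = k.
Proof.
move=> [_ ig g1 _]; rewrite /average RintegralZl ?g1 ?mulr1//.
exact: measurable_itv01_completed.
Qed.

Lemma within_continuousD (R : realType) (D : set R) (phi psi : R -> R) :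
  {within D, continuous phi} -> {within D, continuous psi} ->
  {within D, continuous (fun t => phi t + psi t)}.
Proof. by move=> cphi cpsi t; apply: cvgD; [exact: cphi|exact: cpsi]. Qed.

Lemma within_continuousZ (R : realType) (D : set R) (k : R) (phi : R -> R) :
  {within D, continuous phi} -> {within D, continuous (fun t => k * phi t)}.
Proof. by move=> cphi t; apply: cvgM; [exact: cvg_cst|exact: cphi]. Qed.

Lemma average_le (R : realType) (g phi psi : R -> R) :
  symmetric_distribution g ->
  {within `[0, 1], continuous phi} -> {within `[0, 1], continuous psi} ->
  (forall t, 0 <= t <= 1 -> phi t <= psi t) -> average g phi <= average g psi.
Proof.
move=> gd cphi cpsi le; rewrite -subr_ge0.
have cN := within_continuousZ (k := -1) cphi.
rewrite -mulN1r -averageZ// -averageD//.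
apply: average_ge0 => //; first exact: within_continuousD.
by move=> t t01; rewrite mulN1r subr_ge0 le.
Qed.

Lemma average_norm_le (R : realType) (g phi : R -> R) (k : R) :
  symmetric_distribution g -> {within `[0, 1], continuous phi} ->
  (forall t, 0 <= t <= 1 -> `|phi t| <= k) -> `|average g phi| <= k.
Proof.
move=> gd cphi le; have cc (c : R) : {within `[0, 1], continuous (fun _ : R => c)}.
  by move=> t; exact: cvg_cst.
rewrite ler_norml -(average_cst k gd) -mulN1r -averageZ//.
apply/andP; split; apply: average_le => //; try exact: within_continuousZ;
  by move=> t /le; rewrite ler_norml ?mulN1r => /andP[].
Qed.

Lemma continuous_affine_comp (R : realType) (phi : R -> R) (a s : R) :
  (forall t, 0 <= t <= 1 -> {for a + t * s, continuous phi}) ->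
  {within `[0, 1], continuous (fun t => phi (a + t * s))}.
Proof.
move=> cphi; apply: continuous_in_subspaceT => t; rewrite inE /= in_itv /= => t01.
have /= := @continuous_comp R R R (fun t => a + t * s) phi t.
apply; last exact: cphi.
apply: cvgD; first exact: cvg_cst.
by apply: cvgM; [exact: cvg_id|exact: cvg_cst].
Qed.

(** * Second-order expansions *)

(** Second-order Peano expansion, phi (a + s) = phi a + l s + q s^2 + o(s^2).
    The remainder is stated with explicit bounds because it is later evaluated
    at t s uniformly in t. *)
Definition quad_expansion (R : realType) (phi : R -> R) (a l q : R) : Prop :=
  forall e, 0 < e -> exists2 d, 0 < d & forall s, `|s| <= d ->
    `|phi (a + s) - phi a - l * s - q * s ^+ 2| <= e * s ^+ 2.

Lemma quad_expansion_ext (R : realType) (phi psi : R -> R) (a r l q : R) :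
  0 < r -> (forall s, `|s| <= r -> phi (a + s) = psi (a + s)) ->
  quad_expansion phi a l q -> quad_expansion psi a l q.
Proof.
move=> r0 eq ephi e e0; have [d d0 Hd] := ephi e e0.
exists (Num.min d r); first by rewrite lt_min d0.
move=> s; rewrite le_min => /andP[sd sr].
have := eq 0; rewrite addr0 normr0 => /(_ (ltW r0)) <-.
by rewrite -eq// Hd.
Qed.

Lemma linear_dominated_by_square (R : realType) (A C d : R) :
  0 < d -> (forall s, 0 < s <= d -> A * s <= C * s ^+ 2) -> A <= 0.
Proof.
move=> d0 H; rewrite leNgt; apply/negP => A0.
pose s := Num.min d (A / (2 * (`|C| + 1))).
have C1 : 0 < `|C| + 1 by rewrite ltr_wpDl.
have s0 : 0 < s by rewrite lt_min d0 divr_gt0// mulr_gt0.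
have := H s; rewrite s0 ge_min lexx => /(_ isT).
rewrite expr2 mulrA ler_pM2r// => AC.
have : s * (`|C| + 1) <= A / 2.
  rewrite -ler_pdivlMr// ge_min; apply/orP; right.
  by rewrite invfM mulrA.
have : C * s <= `|C| * s by rewrite ler_wpM2r ?ler_norm// ltW.
lra.
Qed.

(** The difference of the two expansions is A s + B s^2 = o(s^2): the linear part
    is dominated by a square, which kills A, and then |B| is at most any e. *)
Lemma quad_expansion_uniq (R : realType) (phi : R -> R) (a l q l' q' : R) :
  quad_expansion phi a l q -> quad_expansion phi a l' q' -> l = l' /\ q = q'.
Proof.
move=> E E'.
have close e : 0 < e -> exists2 d, 0 < d & forall s, `|s| <= d ->
    `|(l - l') * s + (q - q') * s ^+ 2| <= e * s ^+ 2.
  move=> e0; have e2 : 0 < e / 2 by rewrite divr_gt0.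
  have [d d0 Hd] := E _ e2; have [d' d'0 Hd'] := E' _ e2.
  exists (Num.min d d'); first by rewrite lt_min d0.
  move=> s; rewrite le_min => /andP[sd sd'].
  have := Hd s sd; have := Hd' s sd'.
  rewrite !ler_norml => /andP[? ?] /andP[? ?]; apply/andP; split; lra.
have ll' : l = l'.
  have [d d0 Hd] := close 1 ltr01.
  apply/le_anti; rewrite -subr_le0 -[l' <= l]subr_le0; apply/andP; split.
  - apply: (@linear_dominated_by_square _ _ (1 - (q - q')) d) => // s /andP[s0 sd].
    by have := Hd s; rewrite gtr0_norm// ler_norml => /(_ sd) /andP[_ ?]; lra.
  - apply: (@linear_dominated_by_square _ _ (1 + (q - q')) d) => // s /andP[s0 sd].
    by have := Hd s; rewrite gtr0_norm// ler_norml => /(_ sd) /andP[? _]; lra.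
split => //; apply/eqP; rewrite -subr_eq0 -normr_le0; apply/ler_addgt0Pr => e e0.
have [d d0 Hd] := close e e0; have := Hd d.
rewrite gtr0_norm// ll' subrr mul0r !add0r normrM => /(_ (lexx d)).
by rewrite [`|d ^+ 2|]ger0_norm ?sqr_ge0// ler_pM2r// exprn_gt0.
Qed.

Lemma quad_expansion_linear (R : realType) (phi : R -> R) (a l q : R) :
  quad_expansion phi a l q -> forall e, 0 < e -> exists2 d, 0 < d &
    forall s, `|s| <= d -> `|phi (a + s) - phi a - l * s| <= e * `|s|.
Proof.
move=> E e e0; have [d d0 Hd] := E 1 ltr01.
have q1 : 0 < 1 + `|q| by rewrite ltr_wpDr.
exists (Num.min d (e / (1 + `|q|))); first by rewrite lt_min d0 divr_gt0.
move=> s; rewrite le_min ler_pdivlMr// => /andP[sd se].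
have -> : phi (a + s) - phi a - l * s =
  (phi (a + s) - phi a - l * s - q * s ^+ 2) + q * s ^+ 2 by ring.
apply: (le_trans (ler_normD _ _)); apply: (le_trans (lerD (Hd s sd) (lexx _))).
rewrite normrM -real_normK ?num_real// [`|_ ^+ 2|]ger0_norm ?sqr_ge0//.
by rewrite -mulrDl expr2 mulrA ler_wpM2r// mulrC.
Qed.

(** With k = phi (a + s) - phi a, the error splits into the remainder of psi at
    k, l' times the remainder of phi at s, and q' (k^2 - l^2 s^2); each is at
    most a third of e s^2 for small s. *)
Lemma quad_expansion_comp (R : realType) (phi psi : R -> R) (a l q l' q' : R) :
  quad_expansion phi a l q -> quad_expansion psi (phi a) l' q' ->
  quad_expansion (psi \o phi) a (l' * l) (l' * q + q' * l ^+ 2).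
Proof.
move=> Ephi Epsi e e0.
pose L := `|l| + 1; have L1 : 1 <= L by rewrite /L lerDr.
have L0 : 0 < L by rewrite (lt_le_trans ltr01).
(* L bounds the growth |k| <= L |s|; k1, k2, k3 are the tolerances that make
   the three error terms each at most e / 3 * s ^+ 2. *)
pose k1 := e / (3 * L ^+ 2); pose k2 := e / (3 * (`|l'| + 1)).
pose k3 := e / (3 * (`|q'| + 1) * (2 * L)).
have l'0 : 0 < `|l'| + 1 by rewrite ltr_wpDl.
have q'0 : 0 < `|q'| + 1 by rewrite ltr_wpDl.
have k10 : 0 < k1 by rewrite divr_gt0// mulr_gt0// exprn_gt0.
have k20 : 0 < k2 by rewrite divr_gt0// mulr_gt0.
have k30 : 0 < k3 by rewrite divr_gt0// !mulr_gt0.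
have [d1 d10 H1] := Epsi _ k10.
have [d2 d20 H2] := Ephi _ k20.
have m0 : 0 < Num.min 1 k3 by rewrite lt_min ltr01.
have [d3 d30 H3] := quad_expansion_linear Ephi m0.
exists (Num.min (d1 / L) (Num.min d2 d3)).
  by rewrite !lt_min d20 d30 divr_gt0.
move=> s; rewrite !le_min ler_pdivlMr// => /andP[s1 /andP[s2 s3]] /=.
set k := phi (a + s) - phi a.
have {}H3 : `|k - l * s| <= Num.min 1 k3 * `|s| by exact: H3.
have Hk1 : `|k - l * s| <= `|s|.
  by apply: (le_trans H3); rewrite ler_piMl// ge_min lexx.
have Hk3 : `|k - l * s| <= k3 * `|s|.
  by apply: (le_trans H3); rewrite ler_wpM2r// ge_min lexx orbT.
have kL : `|k| <= L * `|s|.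
  rewrite -[k](subrK (l * s)) (le_trans (ler_normD _ _))//.
  by rewrite normrM /L mulrDl mul1r addrC lerD2l.
have ks : `|k| <= d1 by rewrite (le_trans kL)// mulrC.
have ek : phi (a + s) = phi a + k by rewrite /k; ring.
have {}H1 := H1 k ks; have {}H2 := H2 s s2.
rewrite -ek in H1; rewrite -/k in H2.
have S0 : 0 <= s ^+ 2 by rewrite sqr_ge0.
have sS : `|s| ^+ 2 = s ^+ 2 by rewrite real_normK ?num_real.
have B1 : `|psi (phi (a + s)) - psi (phi a) - l' * k - q' * k ^+ 2|
    <= e / 3 * s ^+ 2.
  apply: (le_trans H1); rewrite -[k ^+ 2]real_normK ?num_real//.
  have : `|k| ^+ 2 <= (L * `|s|) ^+ 2 by rewrite lerXn2r// nnegrE mulr_ge0// ltW.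
  rewrite exprMn sS => kk; apply: (le_trans (ler_wpM2l (ltW k10) kk)).
  have -> : k1 * (L ^+ 2 * s ^+ 2) = e / 3 * s ^+ 2.
    by rewrite /k1; field; rewrite gt_eqF.
  by [].
have B2 : `|l' * (k - l * s - q * s ^+ 2)| <= e / 3 * s ^+ 2.
  rewrite normrM; apply: (le_trans (ler_wpM2l (normr_ge0 _) H2)).
  have -> : `|l'| * (k2 * s ^+ 2) = `|l'| / (`|l'| + 1) * (e / 3 * s ^+ 2).
    by rewrite /k2; field; rewrite gt_eqF.
  apply: ler_piMl; first by rewrite mulr_ge0// divr_ge0// ltW.
  by rewrite ler_pdivrMr// mul1r lerDl.
have B3 : `|q' * (k ^+ 2 - l ^+ 2 * s ^+ 2)| <= e / 3 * s ^+ 2.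
  have -> : k ^+ 2 - l ^+ 2 * s ^+ 2 = (k - l * s) * (k + l * s) by ring.
  have kl : `|k + l * s| <= 2 * L * `|s|.
    rewrite (le_trans (ler_normD _ _))// normrM.
    have : `|l| * `|s| <= L * `|s| by rewrite ler_wpM2r// /L lerDl.
    lra.
  rewrite !normrM.
  have H : `|k - l * s| * `|k + l * s| <= k3 * `|s| * (2 * L * `|s|).
    by rewrite ler_pM.
  apply: (le_trans (ler_wpM2l (normr_ge0 _) H)).
  have -> : `|q'| * (k3 * `|s| * (2 * L * `|s|)) =
      (`|q'| / (`|q'| + 1)) * (e / 3 * s ^+ 2).
    by rewrite -sS /k3; field; rewrite (gt_eqF L0) (gt_eqF q'0).
  apply: ler_piMl; first by rewrite mulr_ge0// divr_ge0// ltW.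
  by rewrite ler_pdivrMr// mul1r lerDl.
have -> : psi (phi (a + s)) - psi (phi a) - l' * l * s
    - (l' * q + q' * l ^+ 2) * s ^+ 2
  = (psi (phi (a + s)) - psi (phi a) - l' * k - q' * k ^+ 2)
    + l' * (k - l * s - q * s ^+ 2) + q' * (k ^+ 2 - l ^+ 2 * s ^+ 2) by ring.
move: B1 B2 B3; set x1 := (_ - _ - _ - _); set x2 := l' * _; set x3 := q' * _.
move=> B1 B2 B3; apply: (le_trans (ler_normD _ _)).
have := ler_normD x1 x2; lra.
Qed.

Lemma derivable_linear (R : realType) (psi : R -> R) (a : R) :
  derivable psi a 1 -> forall e, 0 < e -> exists2 d, 0 < d &
    forall s, `|s| <= d ->
      `|psi (a + s) - psi a - derive1 psi a * s| <= e * `|s|.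
Proof.
move=> der e e0; rewrite derive1E /derive; have /cvgrPdist_le /(_ e e0) := der.
move=> /nbhs_ballP [d /= d0 H]; exists (d / 2); first by rewrite divr_gt0.
move=> s sd; have [->|s0] := eqVneq s 0.
  by rewrite addr0 subrr mulr0 subr0 !normr0 mulr0.
have := H s; rewrite /ball /= sub0r normrN => /(_ _ s0); set l := lim _.
have -> : `|s| < d by rewrite (le_lt_trans sd)// ltr_pdivrMr// ltr_pMr// ltr1n.
move=> /(_ isT); rewrite [s%:A]mulr1 /GRing.scale /= [s + a]addrC => Hs.
have -> : psi (a + s) - psi a - l * s = - (l - s^-1 * (psi (a + s) - psi a)) * s.
  by field.
by rewrite normrM normrN ler_wpM2r.
Qed.

(** The remainder psi of the quadratic Taylor polynomial has derivative
    phi'(a + b) - phi'(a) - phi''(a) b = o(b), so the mean value theorem makes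
    psi itself o(s^2). *)
Lemma quad_expansion_derive2 (R : realType) (phi : R -> R) (a r : R) :
  0 < r -> (forall x, `|x - a| <= r -> derivable phi x 1) ->
  derivable (derive1 phi) a 1 ->
  quad_expansion phi a (derive1 phi a) (derive1 (derive1 phi) a / 2).
Proof.
move=> r0 dphi d2phi e e0.
have [d d0 Hd] := derivable_linear d2phi e0.
exists (Num.min d r); first by rewrite lt_min d0.
move=> s; rewrite le_min => /andP[sd sr].
set l := derive1 phi a; set q := derive1 (derive1 phi) a.
pose psi x := phi x - l * (x - a) - q / 2 * (x - a) ^+ 2.
have dpsi x : `|x - a| <= r ->
    is_derive x 1 psi (derive1 phi x - l - q * (x - a)).
  move=> /dphi dx.
  have Dphi : is_derive x 1 phi (derive1 phi x) by rewrite derive1E; exact/derivableP.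
  have -> : psi = phi - (fun x => l * (x - a))
    - (fun x => q / 2 * (x - a) ^+ 2) by [].
  apply: is_derive_eq.
  by rewrite /GRing.scale /=; field.
suff [b bs eb] : exists2 b, `|b| <= `|s| &
    psi (a + s) - psi a = (derive1 phi (a + b) - l - q * b) * s.
  have -> : phi (a + s) - phi a - l * s - q / 2 * s ^+ 2 = psi (a + s) - psi a.
    by rewrite /psi; ring.
  rewrite eb normrM; apply: (le_trans (ler_wpM2r (normr_ge0 _) (Hd b _))).
    exact: le_trans bs sd.
  rewrite -mulrA ler_pM2l// -[s ^+ 2]real_normK ?num_real// expr2.
  by rewrite ler_wpM2r.
have cpsi x : `|x - a| <= r -> {for x, continuous psi}.
  by move=> /dpsi dx; apply: differentiable_continuous; apply/derivable1_diffP.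
have [s0|s0] := leP 0 s.
- have [|x||c c_in ec] := @MVT_segment _ psi
    (fun x => derive1 phi x - l - q * (x - a)) a (a + s).
  + by rewrite lerDl.
  + rewrite in_itv /= => /andP[x1 x2]; apply: dpsi.
    by rewrite (le_trans _ sr)// !ger0_norm//; lra.
  + apply: continuous_in_subspaceT => x; rewrite inE /= in_itv /= => /andP[x1 x2].
    apply: cpsi.
    by rewrite (le_trans _ sr)// !ger0_norm//; lra.
  + move: c_in; rewrite in_itv /= => /andP[c1 c2].
    exists (c - a); first by rewrite !ger0_norm//; lra.
    by rewrite ec; rewrite [a + (c - a)](_ : _ = c); ring.
- have [|x||c c_in ec] := @MVT_segment _ psi
    (fun x => derive1 phi x - l - q * (x - a)) (a + s) a.
  + by rewrite gerDl ltW.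
  + rewrite in_itv /= => /andP[x1 x2]; apply: dpsi.
    by rewrite (le_trans _ sr)// !ltr0_norm//; lra.
  + apply: continuous_in_subspaceT => x; rewrite inE /= in_itv /= => /andP[x1 x2].
    apply: cpsi.
    by rewrite (le_trans _ sr)// !ler0_norm//; lra.
  + move: c_in; rewrite in_itv /= => /andP[c1 c2].
    exists (c - a); first by rewrite !ler0_norm//; lra.
    by rewrite -opprB ec; rewrite [a + (c - a)](_ : _ = c); ring.
Qed.

(** Averaging is linear and the remainder at t s is at most e (t s)^2 <= e s^2
    for all t in [0,1] at once. *)
Lemma quad_expansion_average (R : realType) (g phi : R -> R) (a r l q : R) :
  symmetric_distribution g -> 0 < r ->
  (forall x, `|x - a| <= r -> {for x, continuous phi}) ->
  quad_expansion phi a l q ->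
  quad_expansion (fun x => average g (fun t => phi (a + t * (x - a)))) a
    (l * average g id) (q * average g (fun t => t ^+ 2)).
Proof.
move=> gd r0 cphi E e e0; have [d d0 Hd] := E e e0.
exists (Num.min d r); first by rewrite lt_min d0.
move=> s; rewrite le_min => /andP[sd sr].
rewrite [a + s - a]addrC addKr subrr.
have -> : average g (fun t => phi (a + t * 0)) = phi a.
  rewrite -[RHS](average_cst _ gd); congr average.
  by apply/funext => t; rewrite mulr0 addr0.
have tsr t : 0 <= t <= 1 -> `|t * s| <= `|s|.
  by move=> /andP[t0 t1]; rewrite normrM ger0_norm// ler_piMl.
have c0 : {within `[0, 1], continuous (fun t => phi (a + t * s))}.
  apply: continuous_affine_comp => t t01; apply: cphi.
  by rewrite addrC addKr (le_trans (tsr t t01)).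
have cc (c : R) : {within `[0, 1], continuous (fun _ : R => c)}.
  by move=> t; exact: cvg_cst.
have c1 : {within `[0, 1], continuous (fun t : R => t)}.
  by apply: continuous_subspaceT => t; exact: cvg_id.
have c2 : {within `[0, 1], continuous (fun t : R => t ^+ 2)}.
  by apply: continuous_subspaceT => t; exact: exprn_continuous.
have -> : average g (fun t => phi (a + t * s)) - phi a - l * average g id * s
      - q * average g (fun t => t ^+ 2) * s ^+ 2
    = average g (fun t => phi (a + t * s) + (- phi a + ((- (l * s)) * t
        + (- (q * s ^+ 2)) * t ^+ 2))).
  have cl := within_continuousZ (k := - (l * s)) c1.
  have cq := within_continuousZ (k := - (q * s ^+ 2)) c2.
  have clq := within_continuousD cl cq.
  rewrite averageD//; last exact: within_continuousD.
  rewrite averageD// averageD// average_cst// !averageZ//.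
  by rewrite /average; ring.
apply: average_norm_le => //.
  apply: within_continuousD => //; apply: within_continuousD => //.
  by apply: within_continuousD; apply: within_continuousZ.
move=> t t01; have ts := tsr t t01.
have := Hd (t * s) (le_trans ts sd).
have -> : phi (a + t * s) - phi a - l * (t * s) - q * (t * s) ^+ 2 =
  phi (a + t * s) + (- phi a + (- (l * s) * t + - (q * s ^+ 2) * t ^+ 2)) by ring.
move=> /le_trans; apply; rewrite ler_pM2l//.
by rewrite -real_normK ?num_real// -[s ^+ 2]real_normK ?num_real// lerXn2r ?nnegrE.
Qed.

(** * Means near the diagonal *)

Lemma mean_diag (R : realType) (M : R -> R -> R) (x : R) :
  is_mean M -> 0 < x -> M x x = x.
Proof.
move=> [_ _ Mb _] x0; have := Mb x x x0 x0.
by rewrite minxx maxxx => /andP[? ?]; apply/le_anti/andP.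
Qed.

(** By symmetry both steps of the path (c,c), (c+k,c), (c+k,c+k) are increments
    in the first variable, M (c,c+k) being M (c+k,c).  Since M (x,x) = x they add
    up to k, while by continuity of the first partial derivative each is about
    k times its value at (c,c). *)
Lemma mean_partial1_diag (R : realType) (M : R -> R -> R) (c : R) :
  is_mean M -> 0 < c -> partial1 M c c = 1 / 2.
Proof.
move=> Mm c0; have [Msm _ _ Msym] := Mm.
have [_ [dM Cp _]] := Msm 2%N; have [cp _] := Cp.
have MVTx (y k : R) : 0 < y -> 0 < k -> exists2 x, c <= x <= c + k &
    M (c + k) y - M c y = partial1 M x y * k.
  move=> y0 k0.
  have pos (x : R) : c <= x -> 0 < x by apply: lt_le_trans.
  have dx (x : R) : 0 < x -> is_derive x 1 (M ^~ y) (partial1 M x y).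
    move=> x0; rewrite /partial1 derive1E; apply/derivableP.
    exact: (proj1 (dM x y x0 y0)).
  have [|x||x xin ex] := @MVT_segment _ (M ^~ y) (fun x => partial1 M x y)
    c (c + k).
  - by rewrite lerDl ltW.
  - by rewrite in_itv /= => /andP[/ltW /pos /dx].
  - apply: continuous_in_subspaceT => x; rewrite inE /= in_itv /= => /andP[/pos /dx ? _].
    by apply: differentiable_continuous; apply/derivable1_diffP.
  - exists x; first by move: xin; rewrite in_itv.
    by rewrite ex; ring.
apply/eqP; rewrite -subr_eq0 -normr_le0; apply/ler_addgt0Pr => e e0; rewrite add0r.
have /cvgrPdist_le /(_ e e0) /nbhs_ballP [d /= d0 Hd] := cp c c c0 c0.
pose k := d / 2; have k0 : 0 < k by rewrite divr_gt0.
have kd : k < d by rewrite ltr_pdivrMr// ltr_pMr// ltr1n.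
have ck0 : 0 < c + k by rewrite addr_gt0.
have [x1 /andP[x1l x1u] e1] := MVTx (c + k) k ck0 k0.
have [x2 /andP[x2l x2u] e2] := MVTx c k c0 k0.
have near1 (x y : R) : c <= x -> x <= c + k -> c <= y -> y <= c + k ->
    `|partial1 M c c - partial1 M x y| <= e.
  move=> *; apply: (Hd (x, y)); clear Hd Msm Msym dM Cp cp Mm.
  by split; rewrite /= /ball /= ler0_norm; lra.
have := near1 x1 (c + k) x1l x1u; rewrite lerDl ltW// => /(_ isT (lexx _)).
have := near1 x2 c x2l x2u (lexx _); rewrite lerDl ltW// => /(_ isT).
have sum1 : partial1 M x1 (c + k) + partial1 M x2 c = 1.
  apply: (mulIf (lt0r_neq0 k0)); rewrite mulrDl -e1 -e2 mul1r.
  by rewrite [M c (c + k)]Msym// !mean_diag//; ring.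
rewrite !ler_norml; clear -sum1; move=> /andP[? ?] /andP[? ?]; apply/andP; split; lra.
Qed.

Lemma mean_quad_expansion (R : realType) (M : R -> R -> R) (c : R) :
  is_mean M -> 0 < c ->
  quad_expansion (M ^~ c) c (1 / 2) (characteristic M c / 2).
Proof.
move=> Mm c0; have [Msm _ _ _] := Mm; rewrite -(mean_partial1_diag Mm c0).
have [_ [dM [_ [dp _ _]] _]] := Msm 2%N.
apply: (@quad_expansion_derive2 _ (M ^~ c) c (c / 2)).
- by rewrite divr_gt0.
- move=> x; rewrite ler_norml => /andP[xl _].
  have x0 : 0 < x by clear -xl c0; lra.
  exact: (proj1 (dM x c x0 c0)).
- exact: (proj1 (dp c c c0 c0)).
Qed.

(** * Strictly monotonic functions onto the half-line *)

(** Encoding the direction of monotonicity as a sign treats the increasing and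
    the decreasing case at once. *)
Lemma strictly_monotonic_sign (R : realType) (I : interval R) (f : R -> R) :
  strictly_monotonic_on I f -> exists2 sg : R, `|sg| = 1 &
    {in I &, forall x y, x < y -> 0 < sg * (f y - f x)}.
Proof.
case=> mono; [exists 1|exists (-1)]; rewrite ?normrN ?normr1// => x y xI yI xy.
- by rewrite mul1r subr_gt0 mono.
- by rewrite mulN1r opprB subr_gt0 mono.
Qed.

(** The values f a / 2 and 2 f a are also taken, and by monotonicity at points of
    I on either side of a. *)
Lemma strictly_monotonic_domain_open (R : realType) (I : interval R)
    (f : R -> R) (a : R) :
  strictly_monotonic_on I f -> f @` [set` I] = `]0, +oo[%classic -> a \in I ->
  exists2 r, 0 < r & forall x, `|x - a| <= r -> x \in I.
Proof.
move=> /strictly_monotonic_sign [sg sg1 mono] fI aI.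
have fa0 : 0 < f a.
  have : (f @` [set` I]) (f a) by exists a.
  by rewrite fI /= in_itv /= andbT.
have hit y : 0 < y -> exists2 b, b \in I & f b = y.
  move=> y0; have : `]0, +oo[%classic y by rewrite /= in_itv /= y0.
  by rewrite -fI => -[b bI <-]; exists b.
have [b bI fb] : exists2 b, b \in I & f b = f a / 2 by apply: hit; rewrite divr_gt0.
have [b' b'I fb'] : exists2 b, b \in I & f b = f a * 2 by apply: hit; rewrite mulr_gt0.
suff [lo [hi [loI hiI loa ahi]]] :
    exists lo hi, [/\ lo \in I, hi \in I, lo < a & a < hi].
  exists (Num.min (a - lo) (hi - a)); first by rewrite lt_min !subr_gt0 loa.
  move=> x; rewrite le_min !ler_norml => /andP[/andP[x1 x2] /andP[x3 x4]].
  apply: (@interval_is_interval _ I lo hi loI hiI).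
  by clear -x1 x4; apply/andP; split; lra.
have side x y : x \in I -> y \in I -> 0 < sg * (f y - f x) -> x < y.
  move=> xI yI H; case: ltgtP => // [yx|xy]; last by rewrite xy subrr mulr0 ltxx in H.
  have := mono _ _ yI xI yx; clear -H; rewrite !mulrBr in H *; lra.
have [sg0|sg0] := leP 0 sg.
- have sg_eq : sg = 1 by rewrite -sg1 ger0_norm.
  exists b, b'; split => //; apply: side; rewrite // sg_eq mul1r ?fb ?fb';
    clear -fa0; lra.
- have sg_eq : sg = -1 by rewrite -sg1 ltr0_norm// opprK.
  exists b', b; split => //; apply: side; rewrite // sg_eq mulN1r ?fb ?fb';
    clear -fa0; lra.
Qed.

(** The formula h' = 1 / (f' o h) holds on all of (0,+oo), in particular near
    f a, and can be differentiated once more. *)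
Lemma inverse_derivatives (R : realType) (I : interval R) (f finv : R -> R)
    (a : R) :
  (forall x, x \in I -> exists2 r, 0 < r & forall y, `|y - x| <= r -> y \in I) ->
  smooth_on I f -> f @` [set` I] = `]0, +oo[%classic -> {in I, cancel f finv} ->
  {in I, forall x, derive1 f x != 0} -> a \in I ->
  is_derive (f a) 1 finv (derive1 f a)^-1 /\
  is_derive (f a) 1 (derive1 finv)
    (- derive1 (derive1 f) a / derive1 f a ^+ 3).
Proof.
move=> Iopen fs fI finvK f'0 aI.
have near_in x : x \in I -> \forall y \near x, y \in I.
  move=> xI; have [r r0 Hr] := Iopen x xI.
  by apply/nbhs_ballP; exists r => // y; rewrite /ball /= distrC => /ltW /Hr.
have Df x : x \in I -> is_derive x 1 f (derive1 f x).
  by move=> xI; rewrite derive1E; apply/derivableP; exact: (fs 0%N).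
have Dinv x : x \in I -> is_derive (f x) 1 finv (derive1 f x)^-1.
  move=> xI; apply: is_derive_inverse.
  - by apply: filterS (near_in x xI) => y /finvK.
  - apply: filterS (near_in x xI) => y yI.
    by apply: differentiable_continuous; apply/derivable1_diffP; exact: (fs 0%N).
  - exact: Df.
  - exact: f'0.
split; first exact: Dinv.
have dinvE : \forall y \near f a, (derive1 f (finv y))^-1 = derive1 finv y.
  have fa0 : 0 < f a.
    have : (f @` [set` I]) (f a) by exists a.
    by rewrite fI /= in_itv /= andbT.
  near=> y; have : `]0, +oo[%classic y.
    by rewrite /= in_itv /= andbT; near: y; exact: lt_nbhsr.
  rewrite -fI => -[x xI <-]; rewrite finvK// [derive1 finv _]derive1E.
  by have [_ ->] := Dinv x xI.
apply: (near_eq_is_derive dinvE).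
have Da := Dinv a aI.
have Df1 : is_derive (finv (f a)) 1 (derive1 f) (derive1 (derive1 f) a).
  rewrite (finvK a aI) [derive1 (derive1 f) a]derive1E; apply/derivableP.
  exact: (fs 1%N a aI).
have nz : (derive1 f \o finv) (f a) != 0 by rewrite /= finvK// f'0.
have Dc : is_derive (f a) 1 (derive1 f \o finv)
    (derive1 (derive1 f) a * (derive1 f a)^-1).
  exact: is_derive1_comp.
have := is_deriveV nz Dc; rewrite /= finvK// => H.
apply: (is_derive_eq H).
by rewrite /GRing.scale /=; field; exact: f'0.
Unshelve. all: end_near.
Qed.

(** * Comparison of the two expansions of the mean *)

(** The comparison of the two expansions of (E), with K = M (., f a). *)
Lemma quad_expansion_average_comp (R : realType) (g f K : R -> R)
    (a r al q l' q' : R) :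
  symmetric_distribution g -> 0 < r ->
  (forall x, `|x - a| <= r -> {for x, continuous f}) ->
  (forall s, `|s| <= r -> K (f (a + s)) = average g (fun t => f (a + t * s))) ->
  quad_expansion f a al q -> quad_expansion K (f a) l' q' ->
  l' * al = al * average g id /\
  l' * q + q' * al ^+ 2 = q * average g (fun t => t ^+ 2).
Proof.
move=> gd r0 cf KE Ef EK.
apply: (quad_expansion_uniq (quad_expansion_comp Ef EK)).
apply: (quad_expansion_ext r0) (quad_expansion_average gd r0 cf Ef) => s sr.
by rewrite [a + s - a]addrC addKr /= KE.
Qed.

(** s is a maximum point of G(s) / s^2 on [0, s0], extended by 0 at 0; the
    extension is continuous since G is o(s^2), and the maximum is positive. *)
Lemma flat_record (R : realType) (G : R -> R) (s0 : R) : 0 < s0 ->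
  (forall s, 0 <= s <= s0 -> {for s, continuous G}) ->
  (forall s, 0 < s <= s0 -> 0 < G s) -> G 0 = 0 ->
  quad_expansion G 0 0 0 ->
  exists2 s, 0 < s <= s0 & forall t, 0 <= t <= 1 -> G (t * s) <= t ^+ 2 * G s.
Proof.
move=> s00 cG Gp G0 E.
(* H 0 = 0 is the limit of G s / s^2 at 0. *)
pose H s := G s * (s ^+ 2)^-1.
have Hp s : 0 < s <= s0 -> 0 < H s.
  by move=> s_in; rewrite /H mulr_gt0 ?Gp// invr_gt0 exprn_gt0//; case/andP: s_in.
have [|s s_in smax] := @EVT_max _ H 0 s0 (ltW s00).
  apply: continuous_in_subspaceT => s; rewrite inE /= in_itv /= => /andP[sl su].
  have [s_eq|sn0] := eqVneq s 0.
    rewrite s_eq; apply/cvgrPdist_le => e e0.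
    have [d d0 Hd] := E e e0; near=> x.
    rewrite /H G0 mul0r sub0r normrN normrM.
    have [->|xn0] := eqVneq x 0; first by rewrite G0 normr0 mul0r ltW.
    have xd : `|x| <= d.
      near: x; apply/nbhs_ballP; exists d => // y.
      by rewrite /ball /= sub0r normrN => /ltW.
    have := Hd x xd; rewrite add0r G0 !mul0r !subr0 => Gx.
    by rewrite [`|_^-1|]gtr0_norm ?invr_gt0 ?exprn_even_gt0// ler_pdivrMr// exprn_even_gt0.
  apply: cvgM; first by apply: cG; rewrite sl su.
  by apply: cvgV; [rewrite expf_neq0|exact: exprn_continuous].
have sp : 0 < s.
  rewrite lt_neqAle; move: (s_in); rewrite in_itv /= => /andP[-> _]; rewrite andbT.
  apply/eqP => s_eq; have := smax s0; rewrite in_itv /= lexx ltW// => /(_ isT).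
  by rewrite leNgt -s_eq {1}/H G0 mul0r Hp// s00 lexx.
exists s; first by move: s_in; rewrite in_itv /= sp => /andP[].
move=> t /andP[t0 t1]; have [->|tn0] := eqVneq t 0.
  by rewrite mul0r G0 expr0n /= mul0r.
have tp : 0 < t by rewrite lt_neqAle eq_sym tn0.
have := smax (t * s); rewrite in_itv /= (mulr_ge0 t0 (ltW sp)) /=.
have -> : t * s <= s0.
  apply: (@le_trans _ _ s); first by rewrite ler_piMl// ltW.
  by move: s_in; rewrite in_itv /= => /andP[].
move=> /(_ isT); rewrite /H ler_pdivrMr ?exprn_gt0 ?mulr_gt0//.
have -> // : G s / s ^+ 2 * (t * s) ^+ 2 = t ^+ 2 * G s.
by field; rewrite gt_eqF.
Unshelve. all: end_near.
Qed.

(** If al = 0 then F(s) = f (a + s) - f a is o(s^2): it changes sign at 0, which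
    excludes a nonzero quadratic term.  At a record s of F(s) / s^2 the averaged
    increment of K is at most <t^2> F(s), below the slope 1/2 of K. *)
Lemma derive_neq0_of_average (R : realType) (g f K : R -> R)
    (sg a r al q q' : R) :
  symmetric_distribution g -> average g (fun t => t ^+ 2) < 1 / 2 ->
  0 < r -> (forall x, `|x - a| <= r -> {for x, continuous f}) ->
  `|sg| = 1 ->
  (forall x y, `|x - a| <= r -> `|y - a| <= r -> x < y ->
    0 < sg * (f y - f x)) ->
  (forall s, `|s| <= r -> K (f (a + s)) = average g (fun t => f (a + t * s))) ->
  quad_expansion f a al q -> quad_expansion K (f a) (1 / 2) q' ->
  al != 0.
Proof.
move=> gd m2 r0 cf sg1 mono KE Ef EK; apply/eqP => al0; subst al.
have inr s : `|s| <= r -> `|a + s - a| <= r by rewrite [a + s]addrC addrK.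
have ain : `|a - a| <= r by rewrite subrr normr0 ltW.
have Kfa : K (f a) = f a.
  have := KE 0; rewrite addr0 normr0 ltW// => /(_ isT) ->.
  rewrite -[RHS](average_cst _ gd); congr average.
  by apply/funext => t; rewrite mulr0 addr0.
pose G s := sg * (f (a + s) - f a).
have Gpos s : 0 < s <= r -> 0 < G s.
  move=> /andP[s0 sr]; apply: mono => //; last by rewrite ltrDl.
  by apply: inr; rewrite gtr0_norm.
have Gneg s : 0 < s <= r -> G (- s) < 0.
  move=> /andP[s0 sr]; rewrite -oppr_gt0 /G -mulrN opprB; apply: mono => //.
  - by apply: inr; rewrite normrN gtr0_norm.
  - by rewrite gtrDl oppr_lt0.
have G0 : G 0 = 0 by rewrite /G addr0 subrr mulr0.
have EG : quad_expansion G 0 0 (sg * q).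
  move=> e e0; have [d d0 Hd] := Ef e e0; exists d => // s /Hd.
  rewrite !add0r G0 subr0 !mul0r !subr0 /G -mulrA -mulrBr normrM sg1 mul1r.
  by [].
(* G s and G (- s) have opposite signs but share the leading term sg * q * s^2. *)
have q0 : sg * q = 0.
  apply/eqP; rewrite -normr_le0; apply/ler_addgt0Pr => e e0; rewrite add0r.
  have [d d0 Hd] := EG e e0; pose s := Num.min d r.
  have s0 : 0 < s by rewrite lt_min d0.
  have sd : `|s| <= d by rewrite gtr0_norm// ge_min lexx.
  have sr : 0 < s <= r by rewrite s0 ge_min lexx orbT.
  have h1 := Hd s sd; have h2 : `|G (- s) - sg * q * s ^+ 2| <= e * s ^+ 2.
    by have := Hd (- s); rewrite normrN !add0r G0 !subr0 mul0r subr0 sqrrN; exact.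
  rewrite !add0r G0 !subr0 mul0r subr0 in h1.
  have ss : 0 < s ^+ 2 by rewrite exprn_gt0.
  have g1 := Gpos s sr; have g2 := Gneg s sr.
  rewrite -(ler_pM2r ss) -[X in _ * X <= _](gtr0_norm ss) -normrM.
  move: h1 h2; rewrite !ler_norml; clear -g1 g2 => /andP[h1 h2] /andP[h3 h4].
  by apply/andP; split; lra.
rewrite q0 in EG.
(* Half the gap between the two slopes: an error of h |k| in the linear
   approximation of K still leaves a contradiction. *)
pose h := (1 / 2 - average g (fun t => t ^+ 2)) / 2.
have h0 : 0 < h by rewrite divr_gt0// subr_gt0.
have [dK dK0 HK] := quad_expansion_linear EK h0.
have [dG dG0 HG] := EG 1 ltr01.
pose s0 := Num.min (Num.min r 1) (Num.min dK dG).
have s00 : 0 < s0 by rewrite !lt_min r0 ltr01 dK0.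
have [s0r s01 s0K s0G] : [/\ s0 <= r, s0 <= 1, s0 <= dK & s0 <= dG].
  by rewrite /s0 !ge_min !lexx !orbT.
have cG s : `|s| <= r -> {for s, continuous G}.
  move=> sr; apply: cvgM; first exact: cvg_cst.
  apply: cvgB; last exact: cvg_cst.
  have /= := @continuous_comp R R R (fun t => a + t) f s.
  apply; last by apply: cf; exact: inr.
  by apply: cvgD; [exact: cvg_cst|exact: cvg_id].
have [||s /andP[sp ss0] smax] := flat_record s00 _ _ G0 EG.
- by move=> s /andP[s1 s2]; apply: cG; rewrite ger0_norm// (le_trans s2).
- by move=> s /andP[s1 s2]; apply: Gpos; rewrite s1 (le_trans s2).
have sr : s <= r := le_trans ss0 s0r.
have nsr : `|s| <= r by rewrite gtr0_norm.
have Gs : 0 < G s by apply: Gpos; rewrite sp.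
have tsr t : 0 <= t <= 1 -> `|t * s| <= r.
  move=> /andP[t0 t1]; apply: le_trans nsr.
  by rewrite normrM ger0_norm// ler_piMl.
set k := f (a + s) - f a.
have kG : `|k| = G s by rewrite -[LHS]mul1r -sg1 -normrM gtr0_norm.
have kK : `|k| <= dK.
  have sdG : `|s| <= dG by rewrite (gtr0_norm sp); exact: le_trans ss0 s0G.
  have := HG s sdG.
  rewrite add0r G0 !mul0r !subr0 mul1r (gtr0_norm Gs) -kG => /le_trans; apply.
  apply: (le_trans _ s0K); apply: (le_trans _ ss0).
  by rewrite expr2; apply: ler_piMl; [exact: ltW|exact: le_trans ss0 s01].
have := HK k kK.
rewrite /k [f a + _]addrC subrK KE// Kfa -/k kG.
have cts : {within `[0, 1], continuous (fun t => f (a + t * s))}.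
  by apply: continuous_affine_comp => t t01; apply: cf; apply: inr; exact: tsr.
have c2 : {within `[0, 1], continuous (fun t : R => t ^+ 2)}.
  by apply: continuous_subspaceT => t; exact: exprn_continuous.
have cc (c : R) : {within `[0, 1], continuous (fun _ : R => c)}.
  by move=> t; exact: cvg_cst.
have avG : average g (fun t => G (t * s)) =
    sg * (average g (fun t => f (a + t * s)) - f a).
  rewrite /G averageZ//; last exact: (within_continuousD cts (cc (- f a))).
  by rewrite averageD// average_cst.
have : average g (fun t => G (t * s)) <= G s * average g (fun t => t ^+ 2).
  rewrite -averageZ//; apply: average_le => //.
  - apply: within_continuousZ; exact: (within_continuousD cts (cc (- f a))).
  - exact: within_continuousZ.
  - by move=> t t01; rewrite [G s * _]mulrC smax.
rewrite avG; set A := average g (fun t => f _) - f a.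
move=> le1 le2.
have : `|sg * (A - 1 / 2 * k)| <= h * G s.
  by rewrite normrM sg1 [1 * `|_|]mul1r; exact: le2.
rewrite mulrBr [sg * (_ * k)]mulrCA -/(G s) ler_norml => /andP[le3 _].
move: le1 le3; rewrite /h; set m := average g _ in m2 *.
set x := sg * A => le1 le3.
have : G s * (1 / 2 - m) > 0 by rewrite mulr_gt0// subr_gt0.
clear -le1 le3; lra.
Qed.

(** * The characteristic function *)

Theorem proposition3p52 (R : realType) (I : interval R) (f finv g : R -> R)
    (f_mono : strictly_monotonic_on I f)
    (f_smooth : smooth_on I f)
    (f_image : f @` [set` I] = `]0, +oo[%classic)
    (finvK : {in I, cancel f finv})
    (g_distr : symmetric_distribution g)
    (M_mean : is_mean (integral_mean2 finv f g)) :
  0 < mu g /\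
  forall x : R, 0 < x ->
    [/\ derivable finv x 1, derivable (derive1 finv) x 1, derive1 finv x != 0 &
        characteristic (integral_mean2 finv f g) x =
          mu g * (derive1n 2 finv x / derive1 finv x)].
Proof.
have c1 : {within `[0, 1], continuous (fun t : R => t)}.
  by apply: continuous_subspaceT => t; exact: cvg_id.
have c2 : {within `[0, 1], continuous (fun t : R => t ^+ 2)}.
  by apply: continuous_subspaceT => t; exact: exprn_continuous.
have muE : mu g = average g id - average g (fun t => t ^+ 2).
  rewrite -[- _]mulN1r -averageZ// -averageD//; last exact: within_continuousZ.
  by apply: eq_Rintegral => t _; ring.
have mu_gt0 : 0 < mu g.
  apply: average_gt0 => //.
    by apply: continuous_subspaceT => t; apply: cvgM; [exact: cvg_id|];
      apply: cvgB; [exact: cvg_cst|exact: cvg_id].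
  by move=> t /andP[t0 t1]; rewrite mulr_gt0 ?subr_gt0.
split=> //.
have Iopen x : x \in I -> exists2 r, 0 < r & forall y, `|y - x| <= r -> y \in I.
  exact: strictly_monotonic_domain_open f_mono f_image.
have f_pos x : x \in I -> 0 < f x.
  move=> xI; have : (f @` [set` I]) (f x) by exists x.
  by rewrite f_image /= in_itv /= andbT.
have f_onto y : 0 < y -> exists2 x, x \in I & f x = y.
  move=> y0; have : `]0, +oo[%classic y by rewrite /= in_itv /= y0.
  by rewrite -f_image => -[x xI <-]; exists x.
have f_cont x : x \in I -> {for x, continuous f}.
  move=> xI; apply: differentiable_continuous; apply/derivable1_diffP.
  exact: (f_smooth 0%N).
have Ef a : a \in I ->
    quad_expansion f a (derive1 f a) (derive1 (derive1 f) a / 2).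
  move=> aI; have [r r0 Hr] := Iopen a aI.
  apply: (quad_expansion_derive2 r0); last exact: (f_smooth 1%N).
  by move=> x /Hr; exact: (f_smooth 0%N).
pose M := integral_mean2 finv f g.
have ME a b : a \in I -> b \in I ->
    M (f b) (f a) = average g (fun t => f (a + t * (b - a))).
  move=> aI bI; apply: eq_Rintegral => t _; rewrite !finvK//.
  by congr (f _ * _); ring.
have EM a : a \in I ->
    quad_expansion (M ^~ (f a)) (f a) (1 / 2) (characteristic M (f a) / 2).
  by move=> /f_pos; exact: mean_quad_expansion.
have local a : a \in I -> exists2 r, 0 < r & [/\
    forall x, `|x - a| <= r -> x \in I,
    forall x, `|x - a| <= r -> {for x, continuous f} &
    forall s, `|s| <= r ->
      M (f (a + s)) (f a) = average g (fun t => f (a + t * s))].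
  move=> aI; have [r r0 Hr] := Iopen a aI; exists r => //; split => //.
    by move=> x /Hr; exact: f_cont.
  move=> s sr; rewrite ME//; last by apply: Hr; rewrite [a + s]addrC addrK.
  by rewrite [a + s]addrC addrK.
have coefs a : a \in I ->
    1 / 2 * derive1 f a = derive1 f a * average g id /\
    1 / 2 * (derive1 (derive1 f) a / 2)
      + characteristic M (f a) / 2 * derive1 f a ^+ 2
    = derive1 (derive1 f) a / 2 * average g (fun t => t ^+ 2).
  move=> aI; have [r r0 [_ cf KE]] := local a aI.
  exact: (quad_expansion_average_comp g_distr r0 cf KE (Ef a aI) (EM a aI)).
(* Only points with f' <> 0 give information on <t>; one exists since f takes
   the two values 1 and 2. *)
have m1 : average g id = 1 / 2.
  suff [a aI a0] : exists2 a, a \in I & derive1 f a != 0.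
    by apply: (mulfI a0); rewrite -(coefs a aI).1 mulrC.
  have [a aI fa] := f_onto 1 ltr01.
  have [b bI fb] := f_onto 2 (ltr0n _ 2).
  apply/not_exists2P => all0.
  have f'0 x : x \in I -> derive1 f x = 0.
    by move=> xI; apply/eqP/negPn/negP; case: (all0 x).
  have const u v : u \in I -> v \in I -> u <= v -> f v = f u.
    move=> uI vI uv.
    have sub x : u <= x <= v -> x \in I.
      exact: (@interval_is_interval _ I u v uI vI).
    have [x||x x_uv ex] := @MVT_segment _ f (derive1 f) u v uv.
    - rewrite in_itv /= => /andP[/ltW ux /ltW xv].
      rewrite derive1E; apply/derivableP; apply: (f_smooth 0%N).
      by apply: sub; rewrite ux.
    - apply: continuous_in_subspaceT => x; rewrite inE /= in_itv /= => /sub.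
      exact: f_cont.
    - apply/eqP; rewrite -subr_eq0 ex f'0 ?mul0r//.
      by apply: sub; move: x_uv; rewrite in_itv.
  have [ab|/ltW ba] := leP a b.
  - by have := const a b aI bI ab; rewrite fa fb => /eqP; rewrite pnatr_eq1.
  - by have := const b a bI aI ba; rewrite fa fb => /esym/eqP; rewrite pnatr_eq1.
have m2 : average g (fun t => t ^+ 2) < 1 / 2 by rewrite -m1 -subr_gt0 -muE.
have [sg sg1 mono] := strictly_monotonic_sign f_mono.
have f'_neq0 : {in I, forall a, derive1 f a != 0}.
  move=> a aI; have [r r0 [inI cf KE]] := local a aI.
  apply: (derive_neq0_of_average g_distr m2 r0 cf sg1 _ KE (Ef a aI) (EM a aI)).
  by move=> x y /inI xI /inI yI; exact: mono.
move=> x x0; have [a aI fa] := f_onto x x0.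
have [D1 D2] := inverse_derivatives Iopen f_smooth f_image finvK f'_neq0 aI.
rewrite fa in D1 D2; have a0 := f'_neq0 a aI.
have e1 : derive1 finv x = (derive1 f a)^-1 by rewrite derive1E; exact: derive_val.
have e2 : derive1n 2 finv x = - derive1 (derive1 f) a / derive1 f a ^+ 3.
  by rewrite /= derive1E; exact: derive_val.
split; [exact: ex_derive|exact: ex_derive|by rewrite e1 invr_eq0|].
rewrite e1 e2 muE m1.
have [_] := coefs a aI; rewrite fa -/M; set m := average g _.
move: (characteristic M x) (derive1 (derive1 f) a) => Q b EQ.
have -> : Q = (b / 2 * m - 1 / 2 * (b / 2)) * 2 / derive1 f a ^+ 2.
  by rewrite -EQ; field.
by field.
Qed.
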